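(* Let $\mathcal{A} \in \mathbb{C}^{n\times n\times p}$ and let $f$ be a scalar function that is $2np-1$ times continuously differentiable on a region containing $\operatorname{spec}(\mathrm{bcirc}(\mathcal{A}))$. Then the Fréchet derivative $L_f(\mathcal{A},\cdot)$ of the tensor t-function $f$ at $\mathcal{A}$ exists, and for any $\mathcal{C}\in\mathbb{C}^{n\times n\times p}$, $$L_f(\mathcal{A},\mathcal{C}) = \mathrm{fold}\big(L_f(\mathrm{bcirc}(\mathcal{A}),\mathrm{bcirc}(\mathcal{C}))\,\boldsymbol{E}_1\big),$$ where on the right-hand side $L_f(\mathrm{bcirc}(\mathcal{A}),\cdot)$ is the Fréchet derivative of the matrix function $f$ at the $np\times np$ matrix $\mathrm{bcirc}(\mathcal{A})$.
   Context: For a third-order tensor $\mathcal{A}\in\mathbb{C}^{n\times m\times p}$ with frontal slices $A^{(1)},\dots,A^{(p)}\in\mathbb{C}^{n\times m}$, $\mathrm{unfold}(\mathcal{A})\in\mathbb{C}^{np\times m}$ is the block column with blocks $A^{(1)},\dots,A^{(p)}$ (top to bottom), and $\mathrm{fold}$ is its inverse. $\mathrm{bcirc}(\mathcal{A})\in\mathbb{C}^{np\times mp}$ is the block circulant matrix whose first block column is $\mathrm{unfold}(\mathcal{A})$, i.e. its $(r,s)$ block is $A^{(((r-s)\bmod p)+1)}$. $\boldsymbol{E}_1 = \boldsymbol{e}_1\otimes I_n\in\mathbb{C}^{np\times n}$, with $\boldsymbol{e}_1$ the first canonical unit vector of $\mathbb{C}^p$. For a square matrix $M$, $f(M)$ is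 the usual (primary) matrix function. The tensor t-function of $\mathcal{A}\in\mathbb{C}^{n\times n\times p}$ is $f(\mathcal{A}) := \mathrm{fold}(f(\mathrm{bcirc}(\mathcal{A}))\boldsymbol{E}_1)$. The norm on tensors is $\|\mathcal{A}\|=\big(\sum_{i,j,k}|\mathcal{A}(i,j,k)|^2\big)^{1/2}$. For both matrix functions and t-functions, the Fréchet derivative at $X$ is the (unique, if it exists) bounded linear map $L_f(X,\cdot)$ with $f(X+E)-f(X)=L_f(X,E)+o(\|E\|)$ as $E\to 0$. *)

(* Defs.v *)
From HB Require Import structures.
From mathcomp Require Import all_boot all_order all_algebra.
From mathcomp Require Import complex ring.
From mathcomp Require Import boolp classical_sets reals topology normedtype derive.

Set Implicit Arguments.
Unset Strict Implicit.
Unset Printing Implicit Defensive.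

Import Order.TTheory GRing.Theory Num.Theory.
Import numFieldNormedType.Exports.

Local Open Scope classical_set_scope.
Local Open Scope ring_scope.

(* An n x m x p tensor is the family of its p frontal slices: A(i, j, k) is
   [A k i j]. *)
Definition tensor (K : Type) (n m p : nat) := {ffun 'I_p -> 'M[K]_(n, m)}.

Section TensorNorm.
Context {K : numClosedFieldType} {n m p : nat}.
Local Notation T := (tensor K n m p).

HB.instance Definition _ :=
  GRing.Lmodule.copy (tensor K n m p) {ffun 'I_p -> 'M[K]_(n, m)}.

Definition tensor_norm (A : T) : K :=
  sqrtC (\sum_(u : 'I_p * ('I_n * 'I_m)) `|A u.1 u.2.1 u.2.2| ^+ 2).

Lemma minkowski2 (I : finType) (x y : I -> K) :
  sqrtC (\sum_i `|x i + y i| ^+ 2) <=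
  sqrtC (\sum_i `|x i| ^+ 2) + sqrtC (\sum_i `|y i| ^+ 2).
Proof.
have ge0 (z : I -> K) : 0 <= \sum_i `|z i| ^+ 2.
  by apply: sumr_ge0 => i _; rewrite exprn_ge0.
set a := sqrtC (\sum_i `|x i| ^+ 2); set b := sqrtC (\sum_i `|y i| ^+ 2).
have a0 : 0 <= a by rewrite sqrtC_ge0.
have b0 : 0 <= b by rewrite sqrtC_ge0.
have aE : \sum_i `|x i| ^+ 2 = a ^+ 2 by rewrite sqrtCK.
have bE : \sum_i `|y i| ^+ 2 = b ^+ 2 by rewrite sqrtCK.
have nil0 (z : I -> K) : \sum_i `|z i| ^+ 2 = 0 -> forall i, `|z i| = 0.
  move=> /eqP; rewrite psumr_eq0 => [/allP z0 i|i _]; last by rewrite exprn_ge0.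
  by apply/eqP; have := z0 i (mem_index_enum _); rewrite /= expf_eq0.
have cs : \sum_i `|x i| * `|y i| <= a * b.
  have [a_eq0|a_neq0] := eqVneq a 0.
    rewrite a_eq0 mul0r big1// => i _.
    by rewrite (nil0 x) ?mul0r// aE a_eq0 expr0n.
  have [b_eq0|b_neq0] := eqVneq b 0.
    rewrite b_eq0 mulr0 big1// => i _.
    by rewrite (nil0 y) ?mulr0// bE b_eq0 expr0n.
  have ab_gt0 : 0 < (a * b) *+ 2.
    by rewrite pmulrn_lgt0// mulr_gt0// lt_def ?a_neq0 ?b_neq0.
  rewrite -(ler_pM2l ab_gt0) mulr_sumr.
  have -> : (a * b) *+ 2 * (a * b) =
      \sum_i (b ^+ 2 * `|x i| ^+ 2 + a ^+ 2 * `|y i| ^+ 2).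
    rewrite big_split/= -!mulr_sumr aE bE mulrnAl -expr2 exprMn mulr2n.
    by rewrite (mulrC (b ^+ 2)).
  apply: ler_sum => i _; rewrite -subr_ge0.
  have -> : b ^+ 2 * `|x i| ^+ 2 + a ^+ 2 * `|y i| ^+ 2
      - (a * b) *+ 2 * (`|x i| * `|y i|) = (b * `|x i| - a * `|y i|) ^+ 2 by ring.
  by rewrite real_exprn_even_ge0// rpredB// realM// ger0_real.
rewrite -(@ler_pXn2r _ 2)// ?nnegrE ?sqrtC_ge0 ?addr_ge0//.
rewrite sqrtCK sqrrD.
apply: (@le_trans _ _ (\sum_i (`|x i| + `|y i|) ^+ 2)).
  by apply: ler_sum => i _; rewrite ler_pXn2r// ?nnegrE ?addr_ge0// ler_normD.
under eq_bigr do rewrite sqrrD.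
by rewrite !big_split/= aE bE mulr2n lerD2r lerD2l lerD.
Qed.

Lemma ler_tensor_normD (A B : T) :
  tensor_norm (A + B) <= tensor_norm A + tensor_norm B.
Proof.
rewrite /tensor_norm.
under eq_bigr do rewrite ffunE mxE.
exact: minkowski2.
Qed.

Lemma tensor_normZ (l : K) (A : T) :
  tensor_norm (l *: A) = `|l| * tensor_norm A.
Proof.
rewrite /tensor_norm.
under eq_bigr do rewrite ffunE mxE normrM exprMn.
rewrite -mulr_sumr sqrtCM ?nnegrE ?exprn_ge0//; last first.
  by apply: sumr_ge0 => i _; rewrite exprn_ge0.
by rewrite sqrCK.
Qed.

Lemma tensor_norm0_eq0 (A : T) : tensor_norm A = 0 -> A = 0.
Proof.
move=> /eqP; rewrite sqrtC_eq0 psumr_eq0 => [/allP A0|u _]; last first.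
  by rewrite exprn_ge0.
apply/ffunP => k; apply/matrixP => i j; rewrite ffunE mxE; apply/eqP.
have := A0 (k, (i, j)) (mem_index_enum _).
by rewrite /= expf_eq0 normr_eq0.
Qed.

(* With this instance the differential ['d] on tensors is the Frechet
   derivative for the norm [tensor_norm]. *)
HB.instance Definition _ := Lmodule_isNormed.Build K T
  ler_tensor_normD tensor_normZ tensor_norm0_eq0.

End TensorNorm.

Section TFunction.
Context {K : numClosedFieldType}.

Definition tunfold {n m p : nat} (A : tensor K n m p) :
  'M[K]_(\sum_(k < p) n, m) := \mxcol_k A k.

Definition tfold {n m p : nat} (X : 'M[K]_(\sum_(k < p) n, m)) :
  tensor K n m p := [ffun k => submxcol X k].

Lemma tunfoldK (n m p : nat) : cancel (@tunfold n m p) tfold.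
Proof. by move=> A; apply/ffunP => k; rewrite ffunE mxcolK. Qed.

Lemma tfoldK (n m p : nat) : cancel (@tfold n m p) tunfold.
Proof.
move=> X; rewrite -[RHS]submxcolK.
by apply/eq_mxcol => k; rewrite ffunE.
Qed.

(* [r - s] is subtraction in 'I_p.+1, i.e. modulo p.+1. *)
Definition bcirc {n m p : nat} (A : tensor K n m p.+1) :
    'M[K]_(\sum_(r < p.+1) n, \sum_(s < p.+1) m) :=
  \mxblock_(r, s) A (r - s).

(* The Kronecker product of the first unit vector with the identity *)
Definition E1 {n p : nat} : 'M[K]_(\sum_(k < p.+1) n, n) :=
  \mxcol_k (if k == 0 then 1%:M else 0 : 'M[K]_n).

(* [mup z psi] is the multiplicity of z as a root of psi.  For psi the minimal
   polynomial of a matrix it is the index of the eigenvalue z (the size of its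
   largest Jordan block), and 0 if z is not an eigenvalue.  [derive1n] is the
   iterated derivative over K, hence the complex derivative for K = R[i]. *)
Definition hermite_interpolant (f : K -> K) (psi q : {poly K}) : Prop :=
  (size q < size psi)%N /\
  forall z j, (j < mup z psi)%N -> q^`(j).[z] = derive1n j f z.

(* The primary matrix function: f(M) := q(M) for the Hermite interpolant q of f
   with respect to the minimal polynomial of M (q always exists and is unique,
   so the default value 0 is never used).  [mxminpoly] and [horner_mx] are only
   available in positive dimension, and there is only one 0 x 0 matrix. *)
Definition mxfun {N : nat} (f : K -> K) : 'M[K]_N -> 'M[K]_N :=
  match N with
  | 0 => id
  | N'.+1 => fun M : 'M[K]_N'.+1 =>
      horner_mx M (xget 0 [set q | hermite_interpolant f (mxminpoly M) q])
  end.

Definition tfun {n p : nat} (f : K -> K) (A : tensor K n n p.+1) :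
  tensor K n n p.+1 := tfold (mxfun f (bcirc A) *m E1).

Definition cont_diff_on (m : nat) (D : set K) (f : K -> K) : Prop :=
  (forall k z, (k < m)%N -> D z -> derivable (derive1n k f) z 1) /\
  (forall z, D z -> {for z, continuous (derive1n m f)}).

End TFunction.

(* Main.v *)
From HB Require Import structures.
From mathcomp Require Import all_boot all_order all_algebra.
From mathcomp Require Import complex ring.
From mathcomp Require Import boolp classical_sets functions reals topology normedtype.
From mathcomp Require Import derive landau interval_inference.
Require Import Defs.

(** The t-function is the matrix function f composed on both sides with linear
    maps between finite-dimensional spaces, [bcirc] and
    [Y |-> tfold (Y *m E1)].  The formula for its derivative is therefore the
    chain rule ([diff_tfun]); what needs an argument is that the primary matrix
    function f is Frechet differentiable at an N x N matrix M as soon as f has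
    2N - 1 continuous derivatives near the spectrum ([differentiable_mxfun]).

    Let s list the eigenvalues of M and x(X) those of a nearby matrix X, with
    multiplicities.  Let P_X be the Hermite interpolant of f at the 2N nodes
    x(X) ++ s.  It computes both values, f(X) = P_X(X) and f(M) = P_X(M)
    ([mxfunE]), so telescoping the powers gives

      f(X) - f(M) = sum_i sum_(a < i) p_i(X) X^(i-1-a) (X - M) M^a

    where p_i(X) is the i-th coefficient of P_X.  The right-hand side is a
    linear map applied to X - M; if the p_i are continuous at M then that
    linear map tends to its value at X = M, which is thus the derivative
    ([differentiable_horner_mx]).  Interpolating at 2N nodes is what consumes
    2N - 1 derivatives of f.

    The continuity of the p_i splits into the continuity of the roots of a
    monic polynomial as functions of its coefficients ([roots_cvg]) and the
    continuity of the interpolant as a function of its nodes ([hermite_cvg]),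
    which by Newton's formula is the continuity of divided differences
    ([divdiff_cvg]).  If two of the limit nodes differ, the recursion
    (a - b) h[a,b,s] = h[a,s] - h[b,s] lowers the number of nodes.  If all of
    them equal a, subtracting the Taylor polynomial of h at a reduces the claim
    to the bound |h[z_0,...,z_k]| <= sup |h^(k)| on a ball ([divdiff_bound]).

    This bound has a proof by induction on k that avoids the integral formula
    of Hermite and Genocchi.  Put a = z_0 and shrink the nodes towards a by
    h_t(z) = h(a + t (z - a)).  Since d/dt h_t = (z - a) h'(a + t (z - a)), and
    since multiplying by z - a before taking a divided difference removes the
    node a ([divdiff_XsubCM]), the derivative in t of h_t[a,z_1,...,z_k] is the
    divided difference of h'(a + t (z - a)) at z_1,...,z_k, to which the
    induction hypothesis applies.  At t = 0 the function is constant and its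
    divided difference vanishes, so the mean value inequality on [0, 1]
    ([mean_value_le]) concludes. *)

Set Implicit Arguments.
Unset Strict Implicit.
Unset Printing Implicit Defensive.

Import Order.TTheory GRing.Theory Num.Theory numFieldNormedType.Exports.
Local Open Scope classical_set_scope.
Local Open Scope ring_scope.

(** * Hermite interpolation and divided differences *)

Section Hermite.
Context {K : numFieldType}.
Implicit Types (d : nat -> K -> K) (s : seq K) (q r : {poly K}) (z a b : K).

Definition node_poly s : {poly K} := \prod_(z <- s) ('X - z%:P).

Lemma node_poly_cons a s : node_poly (a :: s) = ('X - a%:P) * node_poly s.
Proof. by rewrite /node_poly big_cons. Qed.

Lemma monic_node_poly s : node_poly s \is monic.
Proof. exact: monic_prod_XsubC. Qed.

Lemma size_node_poly s : size (node_poly s) = (size s).+1.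
Proof. exact: size_prod_XsubC. Qed.

(** The factor (X - a)^m shifts the derivatives of r at a by m orders. *)
Lemma derivn_XsubC_exp a r m :
  (forall j, (j < m)%N -> (('X - a%:P) ^+ m * r)^`(j).[a] = 0) /\
  (('X - a%:P) ^+ m * r)^`(m).[a] = m`!%:R * r.[a].
Proof.
elim: m r => [|m IH] r; first by rewrite expr0 mul1r derivn0 fact0 mul1r.
have dE : (('X - a%:P) ^+ m.+1 * r)^`() =
    ('X - a%:P) ^+ m * (m.+1%:R *: r + ('X - a%:P) * r^`()).
  rewrite derivM deriv_exp derivXsubC mul1r /= exprS scaler_nat.
  rewrite mulrDr mulrnAl mulrnAr.
  by rewrite [('X - _) * _ ^+ _]mulrC -mulrA.
have [IH1 IH2] := IH (m.+1%:R *: r + ('X - a%:P) * r^`()).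
split=> [[|j] jm|].
- by rewrite derivn0 exprS -mulrA hornerM hornerXsubC subrr mul0r.
- by rewrite derivSn dE IH1.
- rewrite derivSn dE IH2 hornerD hornerZ hornerM hornerXsubC subrr mul0r addr0.
  by rewrite mulrA factS natrM [X in X * _]mulrC.
Qed.

Lemma derivn_dvdXsubC a q m j :
  (('X - a%:P) ^+ m %| q) -> (j < m)%N -> q^`(j).[a] = 0.
Proof.
move=> /dvdpP[r ->] jm; rewrite mulrC.
by have [/(_ j jm)] := derivn_XsubC_exp a r m.
Qed.

Lemma node_poly_split a s : exists2 r, ~~ root r a &
  node_poly s = ('X - a%:P) ^+ count_mem a s * r.
Proof.
have mE : mup a (node_poly s) = count_mem a s by exact: mu_prod_XsubC.
have s0 : node_poly s != 0 by rewrite monic_neq0// monic_node_poly.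
have : ('X - a%:P) ^+ count_mem a s %| node_poly s by rewrite -mup_geq// mE.
move=> /dvdpP[r sE]; exists r; last by rewrite mulrC.
rewrite -dvdp_XsubCl; apply/negP => /dvdpP[r' rE].
have : ('X - a%:P) ^+ (count_mem a s).+1 %| node_poly s.
  by apply/dvdpP; exists r'; rewrite sE rE exprS mulrA.
by rewrite -mup_geq// mE ltnn.
Qed.

(** A node occurring m times in s is a zero of order exactly m of [node_poly s];
    this makes Newton's step from s to [a :: s] solvable. *)
Lemma node_poly_derivn_neq0 a s : (node_poly s)^`(count_mem a s).[a] != 0.
Proof.
have [r ra ->] := node_poly_split a s.
have [_ ->] := derivn_XsubC_exp a r (count_mem a s).
by rewrite mulf_neq0// pnatr_eq0 -lt0n fact_gt0.
Qed.

Lemma node_poly_derivn_eq0 z s j : (j < count_mem z s)%N ->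
  (node_poly s)^`(j).[z] = 0.
Proof.
apply: derivn_dvdXsubC; have [r _ ->] := node_poly_split z s.
exact: dvdp_mulr.
Qed.

(** The data [d j z] stand for the j-th derivative at z of the interpolated
    function; a node occurring m times prescribes the orders j < m. *)
Definition interpolates d s q :=
  forall z j, (j < count_mem z s)%N -> q^`(j).[z] = d j z.

(** Induction on the nodes: if q = r * node_poly s, the vanishing of the next
    derivative of q at a forces r to vanish at a. *)
Lemma dvd_node_poly s q :
  (forall z j, (j < count_mem z s)%N -> q^`(j).[z] = 0) -> node_poly s %| q.
Proof.
elim: s => [|a s IH] q0; first by rewrite /node_poly big_nil dvd1p.
have /IH/dvdpP[r qE] : forall z j, (j < count_mem z s)%N -> q^`(j).[z] = 0.
  by move=> z j js; apply: q0; rewrite /= (leq_trans js) ?leq_addl.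
have [t ta sE] := node_poly_split a s.
have [_] := derivn_XsubC_exp a (t * r) (count_mem a s).
rewrite mulrA -sE mulrC -qE q0 /= ?eqxx// hornerM => /esym/eqP.
rewrite !mulf_eq0 pnatr_eq0 -[_ == 0%N]negbK -lt0n fact_gt0/=.
rewrite -[t.[a] == 0]/(root t a) (negbTE ta)/= -[_ == 0]/(root r a) -dvdp_XsubCl.
by rewrite node_poly_cons qE => ra; rewrite dvdp_mul.
Qed.

Lemma interpolates_uniq d s q r : (size q <= size s)%N -> (size r <= size s)%N ->
  interpolates d s q -> interpolates d s r -> q = r.
Proof.
move=> qs rs qd rd; apply/eqP; rewrite -subr_eq0; apply/negPn/negP => qr0.
have /dvd_node_poly /dvdp_leq :
    forall z j, (j < count_mem z s)%N -> (q - r)^`(j).[z] = 0.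
  by move=> z j js; rewrite derivnB hornerD hornerN qd// rd// subrr.
rewrite size_node_poly => /(_ qr0) /leq_trans/(_ (size_polyD _ _)).
by rewrite size_polyN leqNgt ltnS geq_max qs rs.
Qed.

(** Each entry ((j, z), B) says that the interpolant has the term d j z *: B.
    Keeping the data apart from polynomials that depend on the nodes alone makes
    linearity and differentiability in the data immediate.  The recursive
    clause is Newton's step: the new polynomial B vanishes on the data of the
    tail and is 1 on the new datum, and the old ones are corrected by multiples
    of it. *)
Fixpoint hermite_basis s : seq ((nat * K) * {poly K}) :=
  if s is a :: s' then
    let m := count_mem a s' in
    let B := ((node_poly s')^`(m).[a])^-1 *: node_poly s' in
    ((m, a), B) :: [seq (e.1, e.2 - e.2^`(m).[a] *: B) | e <- hermite_basis s']
  else [::].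

Definition hermite d s : {poly K} :=
  \sum_(e <- hermite_basis s) d e.1.1 e.1.2 *: e.2.

(** The divided difference d[s], as the coefficient of degree [(size s).-1] of the
    interpolant. *)
Definition divdiff d s : K := (hermite d s)`_(size s).-1.

Lemma hermite_nil d : hermite d [::] = 0.
Proof. by rewrite /hermite big_nil. Qed.

Lemma hermite_basis_order s e : e \in hermite_basis s ->
  (e.1.1 < count_mem e.1.2 s)%N.
Proof.
elim: s e => [|a s IH] e //=; rewrite in_cons => /predU1P[->|]/=.
  by rewrite eqxx.
by move=> /mapP[e' /IH e's ->]/=; rewrite (leq_trans e's)// leq_addl.
Qed.

Lemma hermite_newton_step d a s : exists c, hermite d (a :: s) =
   hermite d s + c *: node_poly s /\
   c * (node_poly s)^`(count_mem a s).[a] =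
     d (count_mem a s) a - (hermite d s)^`(count_mem a s).[a].
Proof.
set m := count_mem a s; set B := ((node_poly s)^`(m).[a])^-1 *: node_poly s.
exists ((d m a - (hermite d s)^`(m).[a]) / (node_poly s)^`(m).[a]).
split; last by rewrite divfK ?node_poly_derivn_neq0.
rewrite /hermite/= big_cons big_map/= -/m -/B.
under eq_bigr do rewrite scalerBr scalerA.
rewrite big_split/= sumrN -scaler_suml -scalerA -/B scalerBl addrCA.
congr (_ + (_ - _ *: _)).
rewrite raddf_sum horner_sum; apply: eq_bigr => e _.
by rewrite /= derivnZ hornerZ.
Qed.

Lemma size_hermite d s : (size (hermite d s) <= size s)%N.
Proof.
elim: s => [|a s IH]; first by rewrite hermite_nil size_poly0.
have [c [-> _]] := hermite_newton_step d a s.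
rewrite (leq_trans (size_polyD _ _))// geq_max (leq_trans IH)//=.
by rewrite (leq_trans (size_scale_leq _ _))// size_node_poly.
Qed.

(** Newton's formula: the interpolant depends on its nodes only through divided
    differences and linear factors, which is how its continuity is obtained. *)
Lemma hermite_cons d a s :
  hermite d (a :: s) = hermite d s + divdiff d (a :: s) *: node_poly s.
Proof.
have [c [hE _]] := hermite_newton_step d a s.
rewrite /divdiff hE; congr (_ + _ *: _); rewrite coefD coefZ /=.
rewrite [X in X + _]nth_default ?size_hermite// add0r.
have /monicP := monic_node_poly s.
by rewrite /lead_coef size_node_poly/= => ->; rewrite mulr1.
Qed.

Lemma hermiteP d s : interpolates d s (hermite d s).
Proof.
elim: s => [|a s IH] z j //= js.
have [c [-> cE]] := hermite_newton_step d a s.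
rewrite derivnD derivnZ hornerD hornerZ.
have [js'|] := ltnP j (count_mem z s).
  by rewrite IH// node_poly_derivn_eq0// mulr0 addr0.
move: js; rewrite eq_sym; case: eqP => [->|_]/=; last first.
  by rewrite add0n ltnNge => /negbTE->.
rewrite add1n ltnS => ja aj.
have -> : j = count_mem a s by apply/eqP; rewrite eqn_leq ja.
by rewrite cE addrC subrK.
Qed.

Lemma hermite_unique d s q : (size q <= size s)%N -> interpolates d s q ->
  hermite d s = q.
Proof.
move=> qs qd.
exact: interpolates_uniq (size_hermite d s) qs (@hermiteP d s) qd.
Qed.

Lemma perm_hermite d s t : perm_eq s t -> hermite d s = hermite d t.
Proof.
move=> st; apply: hermite_unique; first by rewrite (perm_size st) size_hermite.
by move=> z j; rewrite (permP st); exact: hermiteP.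
Qed.

Lemma perm_divdiff d s t : perm_eq s t -> divdiff d s = divdiff d t.
Proof. by move=> st; rewrite /divdiff (perm_hermite _ st) (perm_size st). Qed.

Lemma divdiff_sum d s : divdiff d s =
  \sum_(e <- hermite_basis s) d e.1.1 e.1.2 * e.2`_(size s).-1.
Proof.
by rewrite /divdiff /hermite coef_sum; apply: eq_bigr => e _; rewrite coefZ.
Qed.

Lemma divdiffB d d' s :
  divdiff (fun j z => d j z - d' j z) s = divdiff d s - divdiff d' s.
Proof.
by rewrite !divdiff_sum -sumrB; apply: eq_bigr => e _; rewrite mulrBl.
Qed.

Lemma eq_divdiff d d' s : (forall z j, (j < count_mem z s)%N -> d j z = d' j z) ->
  divdiff d s = divdiff d' s.
Proof.
move=> dd; rewrite !divdiff_sum; apply: eq_big_seq => e /hermite_basis_order e_s.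
by rewrite dd.
Qed.

(** A polynomial of small degree is its own interpolant. *)
Lemma divdiff_poly q s : (size q <= size s)%N ->
  divdiff (fun j z => q^`(j).[z]) s = q`_(size s).-1.
Proof. by move=> qs; rewrite /divdiff (hermite_unique qs). Qed.

(** The interpolant at a, b and s does not depend on the order of a and b, so
    Newton's formula expands it in two ways over the interpolant at s; comparing
    the multiples of [node_poly s] gives the recursion. *)
Lemma divdiff_rec d a b s : (a - b) * divdiff d (a :: b :: s) =
  divdiff d (a :: s) - divdiff d (b :: s).
Proof.
have abP : perm_eq (a :: b :: s) (b :: a :: s).
  exact: (permEl (perm_catCA [:: a] [:: b] s)).
have := perm_hermite d abP; rewrite (hermite_cons _ a) (hermite_cons _ b) => E1.
have := hermite_cons d b (a :: s); rewrite (hermite_cons _ a) -E1 => /eqP.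
rewrite -(perm_divdiff d abP) !node_poly_cons -subr_eq0.
set w := node_poly s; set c := divdiff d (a :: b :: s).
have -> : forall h : {poly K}, h + divdiff d (b :: s) *: w + c *: (('X - b%:P) * w) -
    (h + divdiff d (a :: s) *: w + c *: (('X - a%:P) * w)) =
    ((a - b) * c - (divdiff d (a :: s) - divdiff d (b :: s))) *: w.
  move=> h; rewrite -!mul_polyC !polyCB !polyCM !polyCB; ring.
rewrite scaler_eq0 (negbTE (monic_neq0 (monic_node_poly s))) orbF subr_eq0.
by move=> /eqP.
Qed.

(** By Leibniz' rule the data on the left are those of (z - a) u(z), where d are
    the data of u; its interpolant at [a :: s] is X - a times that of u at s. *)
Lemma divdiff_XsubCM d a s :
  divdiff (fun j z => (z - a) * d j z + j%:R * d j.-1 z) (a :: s) = divdiff d s.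
Proof.
have qE q j z : (('X - a%:P) * q)^`(j).[z] =
    (z - a) * q^`(j).[z] + j%:R * q^`(j.-1).[z].
  elim: j q => [|j IH] q; first by rewrite !derivn0 hornerM hornerXsubC mul0r addr0.
  rewrite derivSn derivM derivXsubC mul1r derivnD hornerD IH -derivSn.
  have -> : j%:R * q^`()^`(j.-1).[z] = j%:R * q^`(j).[z].
    by case: j {IH} => [|j]; rewrite ?mul0r// -derivSn.
  by rewrite -[j.+1%:R]natr1 [(j%:R + 1) * _]mulrDl mul1r addrC addrA.
rewrite /divdiff (@hermite_unique _ _ (('X - a%:P) * hermite d s)).
- case: s => [|b s]; first by rewrite hermite_nil mulr0.
  rewrite mulrBl coefB coefXM coefCM/= [X in _ - _ * X]nth_default.
    by rewrite mulr0 subr0.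
  exact: size_hermite.
- rewrite (leq_trans (size_polyMleq _ _))// size_XsubC /= ltnS.
  exact: size_hermite.
- move=> z j /= js; rewrite qE; congr (_ + _).
    have [->|za] := eqVneq z a; first by rewrite subrr !mul0r.
    by rewrite hermiteP//; move: js; rewrite eq_sym (negbTE za).
  case: j js => [|j] js; first by rewrite !mul0r.
  by rewrite /= hermiteP//; move: js; case: eqP; rewrite ?add1n// add0n => _ /ltnW.
Qed.

End Hermite.

(** * The mean value inequality along a complex segment *)

Section MeanValue.
Variable R : realType.
(* The topology of R[i] is inferred from its structure of number field. *)
Local Notation C := (Num.ClosedField.sort (R[i] : numClosedFieldType)).
Local Notation Re := (@complex.Re R).
Local Notation "x %:C" := (real_complex R x).

Lemma Re_continuous : continuous (Re : C -> R).
Proof.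
move=> x A /= [e /= e0 eA]; exists e%:C => /=; first by rewrite ltcR.
move=> y /= xy; apply: eA => /=.
rewrite -ltcR (le_lt_trans _ xy)//; apply: le_trans (normc_ge_Re _).
by rewrite lecR; move: x y {xy} => [a b] [c d].
Qed.

Lemma real_complex_dnbhs0 : (h%:C : C) @[h --> (0 : R)^'] --> (0 : C)^'.
Proof.
move=> A [e /= e0 eA]; have eE : (complex.Re e)%:C = e by rewrite RRe_real ?gtr0_real.
exists (complex.Re e) => /=; first by rewrite -ltcR eE.
move=> h /= he h0; apply: eA; last by apply: contra_neq h0 => -[].
rewrite /= in he *; rewrite -eE.
rewrite sub0r normrN normc_def/= expr0n/= addr0 sqrtr_sqr ltcR.
by rewrite -normrN -sub0r.
Qed.

Lemma is_derive_Re_line (u : C -> C) (c du : C) (t : R) :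
  is_derive (t%:C : C) 1 u du ->
  is_derive t 1 (fun s : R => Re (c * u s%:C)) (Re (c * du)).
Proof.
move=> [uD duE]; pose quot (h : C) := h^-1 *: ((u \o shift t%:C) (h *: 1) - u t%:C).
have quot_cvg : quot h @[h --> (0 : C)^'] --> du by rewrite -duE.
have cquot_cvg : c * quot h%:C @[h --> (0 : R)^'] --> c * du.
  by apply: cvgMl_tmp; exact: cvg_comp real_complex_dnbhs0 quot_cvg.
have : Re (c * quot h%:C) @[h --> (0 : R)^'] --> Re (c * du).
  exact: (cvg_comp _ _ cquot_cvg (@Re_continuous (c * du))).
pose g (s : R) := Re (c * u s%:C).
have -> : (fun h : R => Re (c * quot h%:C)) =
    (fun h : R => h^-1 *: ((g \o shift t) (h *: 1) - g t)).
  apply/funext => h; rewrite /quot /g /= /GRing.scale /= !mulr1 -rmorphD/= -fmorphV.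
  by case: (u _) (u _) (c) => [a b] [a' b'] [x y] /=; simpc => /=; ring.
move=> lE; split; last exact: cvg_lim lE.
by apply/cvg_ex; eexists; exact: lE.
Qed.

(** The real mean value theorem for Re (c * u), where c is the conjugate of
    u 1 - u 0, loses no constant: Re (c * (u 1 - u 0)) = |c| |u 1 - u 0|. *)
Lemma mean_value_le (u du : C -> C) (M : C) :
  (forall t : R, 0 <= t <= 1 -> is_derive (t%:C : C) 1 u (du t%:C)) ->
  (forall t : R, 0 <= t <= 1 -> `|du t%:C| <= M) ->
  `|u 1 - u 0| <= M.
Proof.
move=> uD duM; set c := (u 1 - u 0)^*%C.
have phiD (t : R) : t \in `[0%R, 1%R] ->
    is_derive t 1 (fun s : R => Re (c * u s%:C)) (Re (c * du t%:C)).
  by rewrite in_itv/= => t01; apply: is_derive_Re_line; exact: uD.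
have phiC : {within `[0%R, 1%R], continuous (fun s : R => Re (c * u s%:C))}.
  by apply: derivable_within_continuous => t /phiD tD; exact: ex_derive.
have phiD' (t : R) : t \in `]0%R, 1%R[ ->
    is_derive t 1 (fun s : R => Re (c * u s%:C)) (Re (c * du t%:C)).
  by move=> t01; apply: phiD; apply: subset_itv_oo_cc t01.
have [t t01] := MVT_segment ler01 phiD' phiC.
rewrite subr0 mulr1 -raddfB/= -mulrBr => E.
have [->|u10] := eqVneq (u 1) (u 0).
  by rewrite subrr normr0 (le_trans _ (duM 0 _))// lexx ler01.
have cu : `|c| = `|u 1 - u 0| by rewrite /c normcJ.
rewrite -(ler_pM2l (_ : 0 < `|c|)); last by rewrite cu normr_gt0 subr_eq0.
apply: (@le_trans _ _ (Re (c * du t%:C))%:C).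
  rewrite -E cu -expr2 sqr_normc mulrC RRe_real// -/c.
  by rewrite mulrC -sqr_normc realX// normr_real.
apply: (@le_trans _ _ `|c * du t%:C|).
  by apply: le_trans (normc_ge_Re _); rewrite lecR ler_norm.
by rewrite normrM ler_wpM2l// duM//; move: t01; rewrite in_itv.
Qed.

End MeanValue.

(** * Derivatives of functions of one scalar variable *)

Section DeriveAux.
Context {K : numFieldType}.

Lemma is_derive1_chain (f g : K -> K) (x df dg : K) :
  is_derive x 1 g dg -> is_derive (g x) 1 f df ->
  is_derive x 1 (f \o g) (dg * df).
Proof.
move=> [gD gE] [fD fE].
have gd : differentiable g x := (derivable1_diffP g x).1 gD.
have fd : differentiable f (g x) := (derivable1_diffP f (g x)).1 fD.
have fgd : differentiable (f \o g) x by exact: differentiable_comp.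
split; first exact/derivable1_diffP.
have gd1 : 'd g x 1 = dg by rewrite -deriveE.
have fd1 : 'd f (g x) dg = dg * df by rewrite (deriv1E fD) derive1E fE.
rewrite (deriveE _ fgd) (diff_comp gd fd).
exact: etrans (congr1 _ gd1) fd1.
Qed.

Lemma is_derive1_affine (f : K -> K) (a b t df : K) :
  is_derive (a + t * b) 1 f df ->
  is_derive t 1 (fun s => f (a + s * b)) (b * df).
Proof.
apply: (@is_derive1_chain f (fun s => a + s * b)).
have -> : (fun s => a + s * b) = cst a + b *: id.
  by apply/funext => s; rewrite /= mulrC.
have D := is_deriveD (is_derive_cst a t 1) (is_deriveZ b (is_derive_id t 1)).
by apply: is_derive_eq D _; rewrite add0r /GRing.scale /= mulr1.
Qed.

Lemma is_derive1_exp (n : nat) (t : K) :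
  is_derive t 1 (fun s => s ^+ n) (n%:R * t ^+ n.-1).
Proof.
have -> : (fun s : K => s ^+ n) = id ^+ n by apply/funext => s; rewrite fctE.
have D := is_deriveX n (is_derive_id t 1).
by apply: is_derive_eq D _; rewrite /GRing.scale /= mulr1 mulr_natl.
Qed.

Lemma is_derive1_mul (f g : K -> K) (t df dg : K) :
  is_derive t 1 f df -> is_derive t 1 g dg ->
  is_derive t 1 (fun s => f s * g s) (f t * dg + df * g t).
Proof.
move=> fD gD; apply: is_derive_eq (is_deriveM fD gD) _.
by rewrite /GRing.scale /= [df * _]mulrC.
Qed.

Lemma is_derive_sum_seq (I : eqType) (r : seq I) (F : I -> K -> K)
    (dF : I -> K) (t : K) :
  (forall i, i \in r -> is_derive t 1 (F i) (dF i)) ->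
  is_derive t 1 (fun s => \sum_(i <- r) F i s) (\sum_(i <- r) dF i).
Proof.
elim: r => [|i r IH] FD.
  rewrite big_nil [X in is_derive _ _ X _](_ : _ = cst 0).
    exact: is_derive_cst.
  by apply/funext => s; rewrite big_nil.
rewrite big_cons [X in is_derive _ _ X _](_ : _ = F i + (fun s => \sum_(j <- r) F j s)).
  apply: is_deriveD; first by apply: FD; rewrite mem_head.
  by apply: IH => j jr; apply: FD; rewrite in_cons jr orbT.
by apply/funext => s; rewrite big_cons.
Qed.

Lemma is_derive1_horner (p : {poly K}) (z : K) : is_derive z 1 (horner p) p^`().[z].
Proof.
elim/poly_ind: p => [|p c IH].
  have -> : horner (0 : {poly K}) = cst 0 by apply/funext => y; rewrite horner0.
  by rewrite deriv0 horner0; exact: is_derive_cst.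
have -> : horner (p * 'X + c%:P) = (fun y => p.[y] * y) + cst c.
  by apply/funext => y; rewrite hornerD hornerMX hornerC.
have D := is_deriveD (is_derive1_mul IH (is_derive_id z 1)) (is_derive_cst c z 1).
apply: is_derive_eq D _.
by rewrite derivD derivM derivX derivC !addr0 !mulr1 hornerD hornerMX addrC.
Qed.

Lemma is_derive1_continuous (f : K -> K) (z df : K) :
  is_derive z 1 f df -> {for z, continuous f}.
Proof. by move=> [/derivable1_diffP fd _]; exact: differentiable_continuous. Qed.

(** For fixed nodes a divided difference is a fixed linear combination of the
    data. *)
Lemma is_derive_divdiff (H : K -> nat -> K -> K) (dH : nat -> K -> K)
    (s : seq K) (t : K) :
  (forall j z, (j < count_mem z s)%N -> is_derive t 1 (fun x => H x j z) (dH j z)) ->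
  is_derive t 1 (fun x => divdiff (H x) s) (divdiff dH s).
Proof.
move=> HD; rewrite divdiff_sum.
have -> : (fun x => divdiff (H x) s) = (fun x => \sum_(e <- hermite_basis s)
    H x e.1.1 e.1.2 * e.2`_(size s).-1).
  by apply/funext => x; rewrite divdiff_sum.
pose F (e : nat * K * {poly K}) x := H x e.1.1 e.1.2 * e.2`_(size s).-1.
apply: (@is_derive_sum_seq _ _ F) => e /hermite_basis_order /HD eD.
have D := is_derive1_mul eD (is_derive_cst (e.2`_(size s).-1) t 1).
apply: is_derive_eq D _.
by rewrite mulr0 add0r.
Qed.

End DeriveAux.

(** * A bound for divided differences *)

Section DivdiffBound.
Variable R : realType.
Local Notation C := (Num.ClosedField.sort (R[i] : numClosedFieldType)).
Local Notation "x %:C" := (real_complex R x).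

(** [h j] stands for the j-th derivative of [h 0].  The last function [h k] may
    fail to be differentiable, as for a function that is only C^k. *)
Definition successive_derivatives (k : nat) (B : set C) (h : nat -> C -> C) :=
  forall j z, (j < k)%N -> B z -> is_derive z 1 (h j) (h j.+1 z).

(** Convexity, phrased with the real parameter used by the mean value inequality. *)
Definition segment_closed (B : set C) :=
  forall (z w : C) (t : R), 0 <= t <= 1 -> B z -> B w -> B (z + t%:C * (w - z)).

(** Shrink the nodes towards the first one and apply the mean value inequality in
    the shrinking parameter t; the derivative in t is a divided difference of
    the next function of the family at one node less. *)
Lemma divdiff_bound (B : set C) (k : nat) (h : nat -> C -> C) (M : C) (s : seq C) :
  segment_closed B -> successive_derivatives k B h ->
  (forall z, B z -> `|h k z| <= M) ->
  size s = k.+1 -> (forall z, z \in s -> B z) ->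
  `|divdiff h s| <= M.
Proof.
move=> Bc; elim: k h s => [|k IH] h [//|a s] hD hM /= [sk] sB.
  move: sk sB => /size0nil -> sB.
  rewrite divdiff_sum /= big_seq1 /= /node_poly big_nil hornerC invr1 scale1r.
  by rewrite coef1 mulr1; apply: hM; apply: sB; rewrite mem_head.
have aB : B a by apply: sB; rewrite mem_head.
pose H (t : C) j (z : C) := t ^+ j * h j (a + t * (z - a)).
pose u (t : C) j (z : C) := t ^+ j * h j.+1 (a + t * (z - a)).
have Bt (t : R) z : 0 <= t <= 1 -> z \in a :: s -> B (a + t%:C * (z - a)).
  by move=> t01 zs; apply: Bc => //; exact: sB.
have UD (t : R) : 0 <= t <= 1 ->
    is_derive (t%:C : C) 1 (fun t => divdiff (H t) (a :: s)) (divdiff (u t%:C) s).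
  move=> t01; rewrite -(divdiff_XsubCM _ a); apply: is_derive_divdiff => j z js.
  set y := a + t%:C * (z - a).
  (* The node a does not move: there the datum is t ^+ j times a constant, and
     its order may be j = k.+1.  Elsewhere j <= k, so only functions that are
     known to be differentiable get differentiated. *)
  have [za|za] := eqVneq z a.
    rewrite za subrr mul0r add0r /u subrr mulr0 addr0.
    have -> : (fun x => H x j a) = (fun x => x ^+ j * h j a).
      by apply/funext => x; rewrite /H subrr mulr0 addr0.
    have D := is_derive1_mul (is_derive1_exp j (t%:C : C))
      (is_derive_cst (h j a) (t%:C : C) 1).
    apply: is_derive_eq D _.
    by rewrite mulr0 add0r; case: (j) => [|i]; rewrite ?mul0r//= mulrA.
  have jk : (j < k.+1)%N.
    move: js; rewrite /= eq_sym (negbTE za) add0n -sk => /leq_trans; apply.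
    exact: count_size.
  have zs : z \in a :: s by rewrite -has_pred1 has_count (leq_ltn_trans _ js).
  have hjD : is_derive y 1 (h j) (h j.+1 y).
    by apply: hD => //; exact: Bt.
  have D := is_derive1_mul (is_derive1_exp j (t%:C : C)) (is_derive1_affine hjD).
  apply: is_derive_eq D _.
  rewrite /u -/y mulrCA; congr (_ + _).
  by case: (j) => [|i]; rewrite ?mul0r//= mulrA.
have uM (t : R) : 0 <= t <= 1 -> `|divdiff (u t%:C) s| <= M.
  move=> t01; have [t0 t1] := andP t01; apply: IH => //.
  - move=> j z jk zB; rewrite /u.
    have yE x : a + t%:C * (x - a) = (a - t%:C * a) + x * t%:C.
      by rewrite mulrBr addrCA addrA -addrA [x * _]mulrC; ring.
    have hjD : is_derive ((a - t%:C * a) + z * t%:C) 1 (h j.+1)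
        (h j.+2 ((a - t%:C * a) + z * t%:C)).
      by apply: hD => //; rewrite -yE; exact: Bc.
    under eq_fun do rewrite yE.
    have D := is_derive1_mul (is_derive_cst (t%:C ^+ j : C) z 1)
      (is_derive1_affine hjD).
    apply: is_derive_eq D _.
    by rewrite mul0r addr0 yE exprSr mulrA.
  - move=> z zB; rewrite /u normrM (le_trans _ (hM _ (Bc _ _ _ t01 aB zB)))//.
    rewrite ler_piMl// normrX exprn_ile1// ger0_norm ?ler0c//.
    by rewrite -[1]/(1%:C) lecR.
  - by move=> z zs; apply: sB; rewrite in_cons zs orbT.
have H1 : divdiff (H 1) (a :: s) = divdiff h (a :: s).
  by apply: eq_divdiff => z j _; rewrite /H expr1n !mul1r addrC subrK.
(* The data of H 0 are those of the constant h 0 a. *)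
have H0 : divdiff (H 0) (a :: s) = 0.
  rewrite (@eq_divdiff _ _ (fun j z => (h 0 a)%:P^`(j).[z])).
    rewrite divdiff_poly ?(leq_trans (size_polyC_leq1 _))//=.
    by rewrite coefC sk.
  move=> z j _; rewrite /H mul0r addr0; case: j => [|j].
    by rewrite mul1r hornerC.
  by rewrite expr0n mul0r derivnC horner0.
rewrite -H1 -[divdiff (H 1) _]subr0 -H0.
exact: (@mean_value_le R _ (fun t => divdiff (u t) s) M UD uM).
Qed.

End DivdiffBound.

(** * Continuity of divided differences in the nodes *)

Section DivdiffContinuous.
Variable R : realType.
Local Notation C := (Num.ClosedField.sort (R[i] : numClosedFieldType)).
Local Notation "x %:C" := (real_complex R x).

Lemma segment_closed_ball (a e : C) : segment_closed (ball a e).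
Proof.
move=> z w t /andP[t0 t1]; rewrite -!ball_normE /ball_/= => az aw.
have t0' : 0 <= t%:C by rewrite ler0c.
have t1' : 0 <= 1 - t%:C by rewrite subr_ge0 -[1]/(1%:C) lecR.
have -> : a - (z + t%:C * (w - z)) = (1 - t%:C) * (a - z) + t%:C * (a - w) by ring.
rewrite (le_lt_trans (ler_normD _ _))// !normrM (ger0_norm t0') (ger0_norm t1').
have [t_eq0|t_neq0] := eqVneq t 0.
  by rewrite t_eq0 mul0r addr0 subr0 mul1r.
have -> : e = (1 - t%:C) * e + t%:C * e by ring.
apply: ler_ltD; first by rewrite ler_wpM2l// ltW.
by rewrite ltr_pM2l// ltcR lt_def t_neq0.
Qed.

Lemma near_all (T : Type) (F : set_system T) (I : eqType) (r : seq I)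
    (P : I -> T -> Prop) :
  Filter F -> (forall i, i \in r -> \forall t \near F, P i t) ->
  \forall t \near F, forall i, i \in r -> P i t.
Proof.
move=> FF; elim: r => [|i r IH] Pr; first exact: nearW.
have Pi := Pr i (mem_head _ _).
have {}IH := IH (fun j jr => Pr j (mem_behead (jr : j \in behead (i :: r)))).
apply: filterS2 Pi IH => t Pi Pt j.
by rewrite in_cons => /predU1P[->|/Pt].
Qed.

Lemma successive_derivatives_poly (B : set C) (k : nat) (q : {poly C}) :
  successive_derivatives k B (fun j z => q^`(j).[z]).
Proof.
by move=> j z _ _; rewrite derivnS; exact: is_derive1_horner.
Qed.

(** Induction on the number of nodes.  Nodes are indexed so that a reordering of
    the limit nodes reorders the varying nodes in the same way. *)
Lemma divdiff_cvg (T : Type) (F : set_system T) (I : eqType) (x : T -> I -> C)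
    (x0 : I -> C) (D : set C) (m : nat) (h : nat -> C -> C) (r : seq I) :
  Filter F -> open D -> successive_derivatives m D h ->
  (forall z, D z -> {for z, continuous (h m)}) ->
  (size r <= m.+1)%N -> (forall i, i \in r -> D (x0 i)) ->
  (forall i, i \in r -> x t i @[t --> F] --> x0 i) ->
  divdiff h (map (x t) r) @[t --> F] --> divdiff h (map x0 r).
Proof.
move=> FF Do hD hc.
have [n] := ubnP (size r); elim: n r => [//|n IH] r rn rm rD rx.
case: r => [|i r] in rn rm rD rx *; first exact: cvg_cst.
have [/allP all_eq|/allPn[j jr xij]] := boolP (all (fun j => x0 j == x0 i) r).
  set a := x0 i; set k := size r.
  have x0E : map x0 (i :: r) = nseq k.+1 a.
    rewrite /= -/a; congr (_ :: _); rewrite /k -(size_map x0); apply/all_pred1P.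
    by rewrite all_map; apply/allP => j /all_eq.
  (* q is the Taylor polynomial of h at a, of degree at most k. *)
  pose q := hermite h (map x0 (i :: r)).
  have sq : (size q <= k.+1)%N by rewrite (leq_trans (size_hermite _ _))// size_map.
  pose G j z := h j z - q^`(j).[z].
  have Da : D a by apply: rD; rewrite mem_head.
  have Gk0 : G k a = 0.
    rewrite /G /q hermiteP ?subrr// x0E.
    by rewrite count_nseq /= eqxx mul1n.
  have Gc : {for a, continuous (G k)}.
    apply: continuousB; last exact: is_derive1_continuous (is_derive1_horner _ _).
    move: rm => /=; rewrite ltnS leq_eqVlt => /predU1P[km|km].
      by rewrite /k km; exact: hc.
    exact: is_derive1_continuous (hD k a km Da).
  apply/cvgrPdist_le => e e0.
  have [d /= d0 dB] : nbhs a [set z | D z /\ `|G k z| <= e].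
    apply: filterI; first exact: open_nbhs_nbhs.
    move/cvgrPdist_le : Gc => /(_ e e0); rewrite Gk0.
    by apply: filterS => z; rewrite sub0r normrN.
  have xB : \forall t \near F, forall j, j \in i :: r -> ball a d (x t j).
    apply: near_all => j jr; have /cvgrPdist_lt/(_ d d0) := rx j jr.
    have -> : x0 j = a.
      by move: jr; rewrite in_cons => /predU1P[->//|/all_eq/eqP].
    apply: filterS => t xt.
    exact: xt.
  apply: filterS xB => t xB.
  have -> : divdiff h (map x0 (i :: r)) =
      divdiff (fun j z => q^`(j).[z]) (map (x t) (i :: r)).
    by rewrite divdiff_poly /divdiff !size_map.
  rewrite distrC -divdiffB.
  apply: (@divdiff_bound _ (ball a d) k).
  - exact: segment_closed_ball.
  - move=> j z jk zB; apply: is_deriveB; last first.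
      exact: (@successive_derivatives_poly setT k).
    by apply: hD; [exact: leq_trans jk _ | have [] := dB _ zB].
  - by move=> z zB; have [] := dB _ zB.
  - by rewrite /= size_map.
  - by move=> z; rewrite -map_cons => /mapP[j jr ->]; exact: xB.
pose r' := rem j r.
have rP : perm_eq (i :: r) (i :: j :: r') by rewrite perm_cons perm_to_rem.
have jr' : j \in i :: r by rewrite in_cons jr orbT.
have r'r k : k \in i :: j :: r' -> k \in i :: r by rewrite (perm_mem rP).
rewrite (perm_divdiff h (perm_map x0 rP)).
under eq_fun do rewrite (perm_divdiff h (perm_map (x _) rP)).
have sr' : size r = (size r').+1 by rewrite (perm_size (perm_to_rem jr)).
have sub_cvg a : a \in i :: r ->
    divdiff h (map (x t) (a :: r')) @[t --> F] --> divdiff h (map x0 (a :: r')).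
  move=> ar; have ar' k : k \in a :: r' -> k \in i :: r.
    by rewrite in_cons => /predU1P[->//|kr']; apply: r'r; rewrite !in_cons kr' !orbT.
  apply: IH => [||k /ar'/rD//|k /ar'/rx//].
  - by move: rn; rewrite /= sr'.
  - by move: rm; rewrite /= sr' => /ltnW.
have x0ij : x0 i - x0 j != 0 by rewrite subr_eq0 eq_sym.
have dcvg : x t i - x t j @[t --> F] --> x0 i - x0 j.
  by apply: cvgB; apply: rx => //; rewrite mem_head.
have recE (y : I -> C) : y i - y j != 0 -> divdiff h (map y [:: i, j & r']) =
    (divdiff h (map y (i :: r')) - divdiff h (map y (j :: r'))) * (y i - y j)^-1.
  by move=> yij; rewrite /= -divdiff_rec mulrAC mulfV// mul1r.
rewrite (recE x0 x0ij).
have near_neq : \forall t \near F, x t i - x t j != 0.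
  by apply: (cvgr_neq0 (x0 i - x0 j)).
apply: (@cvg_trans _ ((fun t => (divdiff h (map (x t) (i :: r')) -
    divdiff h (map (x t) (j :: r'))) * (x t i - x t j)^-1) @ F)).
  by apply: near_eq_cvg; apply: filterS near_neq => t tij; rewrite (recE (x t) tij).
apply: cvgM; last exact: cvgV.
by apply: cvgB; apply: sub_cvg => //; rewrite mem_head.
Qed.

End DivdiffContinuous.

(** * Coefficientwise convergence of polynomials *)

Section CoefCvg.
Context {K : numFieldType} {T : Type} {F : set_system T} {FF : Filter F}.
Implicit Types (P Q : T -> {poly K}) (p q : {poly K}).

Definition coef_cvg P p := forall i, (P t)`_i @[t --> F] --> p`_i.

Lemma cvg_sum_seq (I : Type) (r : seq I) (A : pred I) (f : I -> T -> K) (l : I -> K) :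
  (forall i, A i -> f i t @[t --> F] --> l i) ->
  \sum_(i <- r | A i) f i t @[t --> F] --> \sum_(i <- r | A i) l i.
Proof. by move=> fl; apply: cvg_big => //; exact: add_continuous. Qed.

Lemma coef_cvg_cst p : coef_cvg (fun=> p) p.
Proof. by move=> i; exact: cvg_cst. Qed.

Lemma coef_cvgD P Q p q :
  coef_cvg P p -> coef_cvg Q q -> coef_cvg (fun t => P t + Q t) (p + q).
Proof.
move=> Pp Qq i; rewrite coefD; under eq_fun do rewrite coefD.
exact: cvgD (Pp i) (Qq i).
Qed.

Lemma coef_cvgM P Q p q :
  coef_cvg P p -> coef_cvg Q q -> coef_cvg (fun t => P t * Q t) (p * q).
Proof.
move=> Pp Qq i; rewrite coefM; under eq_fun do rewrite coefM.
by apply: cvg_sum_seq => j _; exact: cvgM (Pp j) (Qq _).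
Qed.

Lemma coef_cvgC (c : T -> K) (l : K) :
  c t @[t --> F] --> l -> coef_cvg (fun t => (c t)%:P) l%:P.
Proof.
move=> cl i; rewrite coefC; under eq_fun do rewrite coefC.
by case: (i == 0%N); [exact: cl | exact: cvg_cst].
Qed.

Lemma coef_cvg_sum (I : Type) (r : seq I) (A : pred I) (P : I -> T -> {poly K})
    (p : I -> {poly K}) :
  (forall i, A i -> coef_cvg (P i) (p i)) ->
  coef_cvg (fun t => \sum_(i <- r | A i) P i t) (\sum_(i <- r | A i) p i).
Proof.
move=> Pp j; rewrite coef_sum; under eq_fun do rewrite coef_sum.
by apply: cvg_sum_seq => i Ai; exact: Pp.
Qed.

Lemma coef_cvg_prod (I : Type) (r : seq I) (A : pred I) (P : I -> T -> {poly K})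
    (p : I -> {poly K}) :
  (forall i, A i -> coef_cvg (P i) (p i)) ->
  coef_cvg (fun t => \prod_(i <- r | A i) P i t) (\prod_(i <- r | A i) p i).
Proof.
move=> Pp; elim: r => [|i r IH].
  rewrite big_nil; under eq_fun do rewrite big_nil.
  exact: coef_cvg_cst.
rewrite big_cons; under eq_fun do rewrite big_cons.
by case: ifP => // Ai; apply: coef_cvgM => //; exact: Pp.
Qed.

Lemma coef_cvg_horner P p n (a : K) : (forall t, (size (P t) <= n)%N) ->
  (size p <= n)%N -> coef_cvg P p -> (P t).[a] @[t --> F] --> p.[a].
Proof.
move=> Pn pn Pp; rewrite (horner_coef_wide _ pn).
under eq_fun do rewrite (horner_coef_wide _ (Pn _)).
by apply: cvg_sum_seq => j _; apply: cvgM; [exact: Pp | exact: cvg_cst].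
Qed.

(** The coefficients of the quotient by a monic linear factor are computed from
    the top down, q_k = p_(k+1) + z q_(k+1), and each step is continuous in z. *)
Lemma coef_cvg_factor (z : T -> K) (a : K) Q q n :
  (forall t, (size (Q t) <= n)%N) -> (size q <= n)%N -> z t @[t --> F] --> a ->
  coef_cvg (fun t => ('X - (z t)%:P) * Q t) (('X - a%:P) * q) -> coef_cvg Q q.
Proof.
move=> Qn qn za PQ.
have coefE (c : K) (r : {poly K}) k : r`_k = (('X - c%:P) * r)`_k.+1 + c * r`_k.+1.
  by rewrite mulrBl coefB coefXM coefCM /= subrK.
suff H d k : (n <= k + d)%N -> (Q t)`_k @[t --> F] --> q`_k.
  by move=> k; apply: (H n); exact: leq_addl.
elim: d k => [|d IH] k; rewrite ?addn0 => nk.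
  rewrite (nth_default _ (leq_trans qn nk)).
  by under eq_fun do rewrite (nth_default _ (leq_trans (Qn _) nk)); exact: cvg_cst.
rewrite (coefE a).
have -> : (fun t => (Q t)`_k) =
    (fun t => (('X - (z t)%:P) * Q t)`_k.+1 + z t * (Q t)`_k.+1).
  by apply/funext => t; rewrite -coefE.
by apply: cvgD; [exact: PQ | apply: cvgM => //; apply: IH; rewrite addSnnS].
Qed.

End CoefCvg.
Arguments coef_cvg {K T} F P p.

(** * Continuity of the roots of a polynomial *)

Section Roots.
Context {K : numClosedFieldType}.

Lemma exists_nearest (a : K) (v : seq K) : v != [::] ->
  exists2 z, z \in v & forall w, w \in v -> `|a - z| <= `|a - w|.
Proof.
elim: v => [//|b v IH _]; have [->|/IH[z zv zmin]] := eqVneq v [::].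
  by exists b; rewrite ?mem_head// => w; rewrite inE => /eqP->.
have [bz|zb] := real_leP (normr_real (a - b)) (normr_real (a - z)).
  exists b; rewrite ?mem_head// => w; rewrite in_cons => /predU1P[->//|/zmin].
  exact: le_trans.
exists z; rewrite ?in_cons ?zv ?orbT// => w; rewrite in_cons => /predU1P[->|/zmin//].
exact: ltW.
Qed.

(** |p(a)| is the product of the distances from a to the roots, so it dominates
    the n.+1-th power of the distance to the nearest one. *)
Lemma exists_near_root (a : K) (n : nat) (p : {poly K}) :
  p \is monic -> size p = n.+2 ->
  exists z q, p = ('X - z%:P) * q /\ `|a - z| ^+ n.+1 <= `|p.[a]|.
Proof.
move=> pm ps; have [v] := closed_field_poly_normal p.
rewrite (monicP pm) scale1r -/(node_poly v) => pv.
have vs : size v = n.+1 by apply: succn_inj; rewrite -ps pv size_node_poly.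
have [|z zv zmin] := @exists_nearest a v; first by case: v vs {pv}.
exists z, (node_poly (rem z v)); split.
  by rewrite -node_poly_cons pv; exact: perm_big (perm_to_rem zv).
rewrite pv /node_poly horner_prod normr_prod -vs.
have -> : `|a - z| ^+ size v = \prod_(w <- v) `|a - z|.
  by rewrite big_const_seq count_predT iter_mulr_1.
rewrite big_seq [leRHS]big_seq; apply: ler_prod => w /zmin wv.
by rewrite normr_ge0 hornerXsubC.
Qed.

(** Select the root nearest to the first limit root a: it tends to a because p(a)
    is small.  Then divide it out and continue with the quotient.  The choice is
    made for each t separately, so the functions [x] do not depend on a
    prescribed accuracy. *)
Lemma roots_cvg (T : Type) (F : set_system T) (P : T -> {poly K}) (s : seq K) :
  Filter F -> (forall t, P t \is monic) -> (forall t, size (P t) = (size s).+1) ->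
  coef_cvg F P (node_poly s) ->
  exists x : T -> seq K, [/\ forall t, size (x t) = size s,
    forall t, P t = node_poly (x t) &
    forall i, (x t)`_i @[t --> F] --> s`_i].
Proof.
move=> FF; elim: s P => [|a s IH] P Pm Ps Pp.
  exists (fun=> [::]); split=> // [t|i]; last exact: cvg_cst.
  have /size_poly1P[c c0 cE] : size (P t) == 1 by rewrite Ps.
  by have := Pm t; rewrite cE monicE lead_coefC => /eqP->; rewrite /node_poly big_nil.
have /choice[zq zqP] : forall t, exists zq : K * {poly K},
    P t = ('X - zq.1%:P) * zq.2 /\ `|a - zq.1| ^+ (size s).+1 <= `|(P t).[a]|.
  move=> t; have [z [q zqP]] := exists_near_root a (Pm t) (Ps t).
  by exists (z, q).
pose z t := (zq t).1; pose Q t := (zq t).2.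
have PE t : P t = ('X - (z t)%:P) * Q t by have [] := zqP t.
have za : z t @[t --> F] --> a.
  have P0 : (P t).[a] @[t --> F] --> 0.
    have -> : 0 = (node_poly (a :: s)).[a].
      by rewrite node_poly_cons hornerM hornerXsubC subrr mul0r.
    apply: (@coef_cvg_horner _ _ _ _ _ _ (size s).+2) => // [t|].
      by rewrite Ps.
    by rewrite size_node_poly.
  apply/cvgrPdist_lt => e e0.
  have en0 : 0 < e ^+ (size s).+1 by rewrite exprn_gt0.
  have /cvgr0Pnorm_lt/(_ _ en0) := P0; apply: filterS => t Pt.
  have [_ /le_lt_trans/(_ Pt)] := zqP t.
  by rewrite ltr_pXn2r ?nnegrE// ltW.
have Qm t : Q t \is monic.
  by have := Pm t; rewrite PE monicMl ?monicXsubC.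
have Qs t : size (Q t) = (size s).+1.
  have := Ps t; rewrite PE size_Mmonic ?polyXsubC_eq0 ?Qm // size_XsubC /=.
  by case.
have Qq : coef_cvg F Q (node_poly s).
  apply: (@coef_cvg_factor _ _ _ _ z a _ _ (size s).+1) => //.
  - by move=> t; rewrite Qs.
  - by rewrite size_node_poly.
  - by rewrite -node_poly_cons; under eq_fun do rewrite -PE.
have [x [xs Qx xc]] := IH Q Qm Qs Qq.
exists (fun t => z t :: x t); split=> [t|t|[|i]] //=; first by rewrite xs.
by rewrite node_poly_cons -Qx.
Qed.

Lemma char_poly_cvg (n : nat) (A : 'M[K]_n) : coef_cvg (nbhs A) char_poly (char_poly A).
Proof.
apply: coef_cvg_sum => s _; apply: coef_cvgM; first exact: coef_cvg_cst.
apply: coef_cvg_prod => i _; rewrite /char_poly_mx.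
under eq_fun do rewrite !mxE; rewrite !mxE.
apply: coef_cvgD; first exact: coef_cvg_cst.
under eq_fun do rewrite -polyCN; rewrite -polyCN.
by apply: coef_cvgC; apply: cvgN; exact: coord_continuous.
Qed.

End Roots.

(** * Norms and limits of matrices, criteria for differentiability *)

Section MatrixNorm.
Context {K : numFieldType}.

Lemma mx_entry_le (m n : nat) (A : 'M[K]_(m, n)) i j : `|A i j| <= `|A|.
Proof.
rewrite [leRHS]/Num.Def.normr /= mx_normE -[leLHS]nngE num_le.
exact: (le_bigmax _ _ (i, j)).
Qed.

Lemma mx_norm_le (m n : nat) (A : 'M[K]_(m, n)) (c : K) : 0 <= c ->
  (forall i j, `|A i j| <= c) -> `|A| <= c.
Proof.
move=> c0 Ac; have [->//|A0] := eqVneq `|A| 0.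
by have [[i j] AE] := mx_norm_neq0 A0; rewrite [`|A|]AE; exact: Ac.
Qed.

Lemma mx_normM (m n p : nat) (A : 'M[K]_(m, n)) (B : 'M[K]_(n, p)) :
  `|A *m B| <= n%:R * `|A| * `|B|.
Proof.
apply: mx_norm_le => [|i j]; first by rewrite !mulr_ge0.
rewrite mxE (le_trans (ler_norm_sum _ _ _))//.
rewrite -mulrA mulr_natl -[X in _ *+ X]card_ord -sumr_const ler_sum// => k _.
by rewrite normrM ler_pM// mx_entry_le.
Qed.

Lemma mx_cvg (T : Type) (F : set_system T) (m n : nat) (f : T -> 'M[K]_(m, n))
    (A : 'M[K]_(m, n)) : Filter F ->
  (forall i j, f t i j @[t --> F] --> A i j) -> f t @[t --> F] --> A.
Proof.
move=> FF fA U [P Pn PU].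
have : \forall t \near F, forall i j, P i j (f t i j).
  by apply: filter_forall => i; apply: filter_forall => j; exact: fA (Pn i j).
by apply: filterS => t /PU.
Qed.

Lemma mulmx_cvg (T : Type) (F : set_system T) (m n p : nat)
    (f : T -> 'M[K]_(m, n)) (g : T -> 'M[K]_(n, p))
    (A : 'M[K]_(m, n)) (B : 'M[K]_(n, p)) : Filter F ->
  f t @[t --> F] --> A -> g t @[t --> F] --> B ->
  f t *m g t @[t --> F] --> A *m B.
Proof.
move=> FF fA gB; apply: mx_cvg => i j; rewrite mxE.
under eq_fun do rewrite mxE.
apply: cvg_sum_seq => k _; apply: cvgM.
  exact: (cvg_comp _ _ fA (@coord_continuous _ _ _ _ _ A)).
exact: (cvg_comp _ _ gB (@coord_continuous _ _ _ _ _ B)).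
Qed.

Lemma mxexp_cvg (T : Type) (F : set_system T) (n k : nat)
    (f : T -> 'M[K]_n.+1) (A : 'M[K]_n.+1) : Filter F ->
  f t @[t --> F] --> A -> f t ^+ k @[t --> F] --> A ^+ k.
Proof.
move=> FF fA; elim: k => [|k IH]; first by apply: mx_cvg => i j; exact: cvg_cst.
rewrite exprS; under eq_fun do rewrite exprS.
exact: mulmx_cvg.
Qed.

(** [differentiable] is about the chosen map ['d f x]; a continuous linear
    first-order approximation is unique, hence equal to it. *)
Lemma differentiable_linear_approx (V W : normedModType K) (f : V -> W)
    (L : {linear V -> W}) (x : V) : continuous L ->
  (forall e, 0 < e -> \forall y \near x, `|f y - f x - L (y - x)| <= e * `|y - x|) ->
  differentiable f x.
Proof.
move=> Lc fL.
have fE : f \o shift x = cst (f x) + L +o_ (0 : V) id.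
  apply/eqaddoP => e e0; have := fL e e0.
  rewrite (near_shift 0) subr0; apply: filterS => h /=.
  by rewrite addrK opprD addrA.
by apply/diff_locallyP; rewrite (diff_unique Lc fE).
Qed.

Lemma lipschitz_linear_continuous (V W : normedModType K) (f : {linear V -> W}) (k : K) :
  0 <= k -> (forall x, `|f x| <= k * `|x|) -> continuous f.
Proof.
move=> k0 fk; apply: bounded_linear_continuous.
exists k; split=> [|M kM]; first exact: ger0_real.
apply: filterS (nbhsx_ballx (0 : V) 1 ltr01) => x.
rewrite -ball_normE /= sub0r normrN => /ltW x1.
by rewrite (le_trans (fk x))// (le_trans _ (ltW kM))// ler_piMr.
Qed.

End MatrixNorm.

(** * Primary matrix functions through interpolation *)

Section PrimaryFunction.
Context {K : numClosedFieldType}.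

Lemma mup_dvdp (z : K) (p q : {poly K}) : q != 0 -> p %| q ->
  (mup z p <= mup z q)%N.
Proof.
move=> q0 pq; rewrite mup_geq//; apply: (dvdp_trans _ pq).
by rewrite -mup_geq// (dvdpN0 pq).
Qed.

(** Interpolating f at a list of nodes that contains the roots of the
    characteristic polynomial is more than interpolating it on the minimal
    polynomial psi: two such polynomials agree modulo psi, hence at M.  This is
    what allows one polynomial to evaluate f at two matrices. *)
Lemma mxfunE (n : nat) (f : K -> K) (M : 'M[K]_n.+1) (s : seq K) (q : {poly K}) :
  char_poly M %| node_poly s -> interpolates (fun j => derive1n j f) s q ->
  mxfun f M = horner_mx M q.
Proof.
move=> Ms qs /=; set psi := mxminpoly M.
have psi0 : psi != 0 by rewrite monic_neq0// mxminpoly_monic.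
have psis z : (mup z psi <= count_mem z s)%N.
  rewrite -(mu_prod_XsubC z s) -/(node_poly s) mup_dvdp//.
    by rewrite monic_neq0// monic_node_poly.
  exact: dvdp_trans (mxminpoly_dvd_char M) Ms.
have [r rP] : exists r, hermite_interpolant f psi r.
  exists (q %% psi); split=> [|z j jz]; first by rewrite ltn_modp.
  rewrite -(qs z j (leq_trans jz (psis z))).
  rewrite [in RHS](divp_eq q psi) derivnD hornerD.
  rewrite [X in _ = X + _](_ : _ = 0) ?add0r//.
  apply: (@derivn_dvdXsubC _ _ _ (mup z psi)) => //.
  by apply: dvdp_mull; rewrite -mup_geq.
have [_ gs] := @xgetPex _ 0 [set q | hermite_interpolant f psi q] (ex_intro _ r rP).
set g := xget _ _ in gs *.
(* v lists the roots of psi, so that [dvd_node_poly] applies to psi. *)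
have [v] := closed_field_poly_normal psi.
rewrite (monicP (mxminpoly_monic M)) scale1r -/(node_poly v) => psiv.
have : psi %| g - q.
  rewrite psiv; apply: dvd_node_poly => z j jv.
  have jz : (j < mup z psi)%N by rewrite psiv /node_poly mu_prod_XsubC.
  by rewrite derivnB hornerD hornerN gs// qs ?subrr// (leq_trans jz).
move=> /dvdpP[t gqE]; apply/eqP; rewrite -subr_eq0 -rmorphB/= gqE rmorphM/=.
by rewrite mx_root_minpoly mulr0.
Qed.

End PrimaryFunction.

Section MatrixPowers.
Context {K : numFieldType}.

Lemma horner_mx_wide (n m : nat) (M : 'M[K]_n.+1) (q : {poly K}) :
  (size q <= m)%N -> horner_mx M q = \sum_(i < m) q`_i *: M ^+ i.
Proof.
move=> qm; have qE : q = \sum_(i < m) q`_i *: 'X^i.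
  rewrite -poly_def; apply/polyP => i; rewrite coef_poly.
  by case: ltnP => // mi; rewrite nth_default// (leq_trans qm).
rewrite [in LHS]qE raddf_sum /=; apply: eq_bigr => i _.
by rewrite linearZ /= rmorphXn /= horner_mx_X.
Qed.

(** X and M need not commute, hence the explicit order of the factors. *)
Lemma exp_sub_telescope (n k : nat) (X M : 'M[K]_n.+1) :
  X ^+ k - M ^+ k = \sum_(a < k) X ^+ (k.-1 - a) * (X - M) * M ^+ a.
Proof.
elim: k => [|k IH]; first by rewrite !expr0 subrr big_ord0.
rewrite big_ord_recr /= subnn expr0 mul1r.
have -> : \sum_(a < k) X ^+ (k - a) * (X - M) * M ^+ a =
    X * \sum_(a < k) X ^+ (k.-1 - a) * (X - M) * M ^+ a.
  rewrite mulr_sumr; apply: eq_bigr => a _; rewrite !mulrA -exprS.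
  by case: k a {IH} => [[]//|k] a /=; rewrite subSn// -ltnS.
by rewrite -IH mulrBr -exprS mulrBl -exprS addrA subrK.
Qed.

End MatrixPowers.

Section MatrixFunction.
Variable R : realType.
Local Notation C := (Num.ClosedField.sort (R[i] : numClosedFieldType)).

(** Newton's formula expresses the interpolant through divided differences and
    products of linear factors, each depending continuously on the nodes. *)
Lemma hermite_cvg (T : Type) (F : set_system T) (I : eqType) (x : T -> I -> C)
    (x0 : I -> C) (D : set C) (m : nat) (h : nat -> C -> C) (r : seq I) :
  Filter F -> open D -> successive_derivatives m D h ->
  (forall z, D z -> {for z, continuous (h m)}) ->
  (size r <= m.+1)%N -> (forall i, i \in r -> D (x0 i)) ->
  (forall i, i \in r -> x t i @[t --> F] --> x0 i) ->
  coef_cvg F (fun t => hermite h (map (x t) r)) (hermite h (map x0 r)).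
Proof.
move=> FF Do hD hc; elim: r => [|i r IH] rm rD rx.
  under eq_fun do rewrite hermite_nil.
  by rewrite hermite_nil; exact: coef_cvg_cst.
have rD' j : j \in r -> D (x0 j) by move=> jr; apply: rD; rewrite in_cons jr orbT.
have rx' j : j \in r -> x t j @[t --> F] --> x0 j.
  by move=> jr; apply: rx; rewrite in_cons jr orbT.
have node_cvg : coef_cvg F (fun t => node_poly (map (x t) r)) (node_poly (map x0 r)).
  elim: r rx' {IH rm rD rx rD'} => [|j r IH] rx; first exact: coef_cvg_cst.
  rewrite /= node_poly_cons; under eq_fun do rewrite node_poly_cons.
  apply: coef_cvgM; last by apply: IH => k kr; apply: rx; rewrite in_cons kr orbT.
  apply: coef_cvgD; first exact: coef_cvg_cst.
  under eq_fun do rewrite -polyCN; rewrite -polyCN.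
  by apply: coef_cvgC; apply: cvgN; apply: rx; rewrite mem_head.
rewrite /= hermite_cons -mul_polyC.
under eq_fun do rewrite hermite_cons -mul_polyC.
apply: coef_cvgD; first by apply: IH => //; exact: ltnW.
apply: coef_cvgM node_cvg; apply: coef_cvgC.
exact: (divdiff_cvg FF Do hD hc rm rD rx).
Qed.

End MatrixFunction.

(** * Frechet differentiability of matrix functions *)

Section PolynomialFamily.
Context {K : numFieldType}.

(** If one polynomial P X computes F at both X and M, then F X - F M is a linear
    map applied to X - M, with coefficients that converge as X tends to M. *)
Lemma differentiable_horner_mx (n m : nat) (M : 'M[K]_n.+1)
    (F : 'M[K]_n.+1 -> 'M[K]_n.+1) (P : 'M[K]_n.+1 -> {poly K}) (p : {poly K}) :
  (forall X, (size (P X) <= m)%N) -> coef_cvg (nbhs M) P p ->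
  (forall X, F X = horner_mx X (P X)) -> (forall X, F M = horner_mx M (P X)) ->
  differentiable F M.
Proof.
move=> Pm Pp FX FM; have nbhsM : Filter (nbhs M) := nbhs_filter M.
pose A X (i : 'I_m) a := (P X)`_i *: X ^+ (i.-1 - a).
pose A0 (i : 'I_m) a := p`_i *: M ^+ (i.-1 - a).
pose L (E : 'M[K]_n.+1) := \sum_(i < m) \sum_(a < i) A0 i a * E * M ^+ a.
have L_linear : linear L.
  move=> c E E'; rewrite /L scaler_sumr -big_split; apply: eq_bigr => i _ /=.
  rewrite scaler_sumr -big_split; apply: eq_bigr => a _ /=.
  by rewrite mulrDr mulrDl -scalerAr -scalerAl.
pose Lmix := GRing.isLinear.Build _ _ _ _ L L_linear.
pose LL : {linear 'M[K]_n.+1 -> 'M[K]_n.+1} := HB.pack L Lmix.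
(* Each matrix product costs a factor n.+1 in the maximum norm. *)
pose w (a : nat) : K := n.+1%:R * n.+1%:R * `|M ^+ a|.
have w0 a : 0 <= w a by rewrite !mulr_ge0.
have term_le (B E : 'M[K]_n.+1) a : `|B * E * M ^+ a| <= `|B| * w a * `|E|.
  rewrite (le_trans (mx_normM _ _))// /w.
  have := mx_normM B E; move: `|M ^+ a| (normr_ge0 (M ^+ a)) => c c0 BE.
  apply: (@le_trans _ _ (n.+1%:R * (n.+1%:R * `|B| * `|E|) * c)).
    by rewrite ler_wpM2r// ler_wpM2l.
  by rewrite le_eqVlt; apply/orP; left; apply/eqP; ring.
pose kappa X := \sum_(i < m) \sum_(a < i) `|A X i a - A0 i a| * w a.
have FE X : F X - F M - L (X - M) =
    \sum_(i < m) \sum_(a < i) (A X i a - A0 i a) * (X - M) * M ^+ a.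
  rewrite FX (FM X) !(horner_mx_wide _ (Pm X)) -!sumrB.
  apply: eq_bigr => i _; rewrite -scalerBr exp_sub_telescope scaler_sumr -sumrB.
  apply: eq_bigr => a _; move: (X - M) => E.
  by rewrite [in RHS]mulrBl [in RHS]mulrBl -!scalerAl.
have FL X : `|F X - F M - L (X - M)| <= kappa X * `|X - M|.
  rewrite FE (le_trans (ler_norm_sum _ _ _))// mulr_suml ler_sum// => i _.
  by rewrite (le_trans (ler_norm_sum _ _ _))// mulr_suml ler_sum.
have kappa0 : kappa X @[X --> M] --> 0.
  have -> : 0 = \sum_(i < m) \sum_(a < i) `|A0 i a - A0 i a| * w a :> K.
    by rewrite big1// => i _; rewrite big1// => a _; rewrite subrr normr0 mul0r.
  apply: cvg_sum_seq => i _; apply: cvg_sum_seq => a _.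
  apply: cvgM; last exact: cvg_cst.
  apply: cvg_norm; apply: cvgB; last exact: cvg_cst.
  apply: cvgZ; first exact: Pp.
  by apply: mxexp_cvg; exact: cvg_id.
apply: (@differentiable_linear_approx _ _ _ F LL).
  pose l := \sum_(i < m) \sum_(a < i) `|A0 i a| * w a.
  apply: (@lipschitz_linear_continuous _ _ _ _ l).
    by rewrite sumr_ge0// => i _; rewrite sumr_ge0// => a _; rewrite mulr_ge0.
  move=> E; rewrite (le_trans (ler_norm_sum _ _ _))// mulr_suml ler_sum// => i _.
  by rewrite (le_trans (ler_norm_sum _ _ _))// mulr_suml ler_sum.
move=> e e0; have /cvgr0Pnorm_le/(_ e e0) := kappa0; apply: filterS => X kX.
have kappa_ge0 : 0 <= kappa X.
  by rewrite sumr_ge0// => i _; rewrite sumr_ge0// => a _; rewrite mulr_ge0.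
by rewrite (le_trans (FL X))// ler_wpM2r// -(ger0_norm kappa_ge0).
Qed.

End PolynomialFamily.

Section Frechet.
Variable R : realType.
Local Notation C := (Num.ClosedField.sort (R[i] : numClosedFieldType)).

Lemma cont_diff_successive_derivatives (m : nat) (D : set C) (f : C -> C) :
  cont_diff_on m D f -> successive_derivatives m D (fun j => derive1n j f).
Proof.
by move=> [fD _] j z jm Dz; split; [exact: fD | rewrite derive1nS derive1E].
Qed.

(** The interpolant of f at the eigenvalues of X together with those of M serves
    as the family P X of [differentiable_horner_mx]. *)
Lemma differentiable_mxfun (n : nat) (M : 'M[C]_n) (f : C -> C) (D : set C) :
  open D -> [set z | eigenvalue M z] `<=` D -> cont_diff_on (2 * n).-1 D f ->
  differentiable (mxfun f) M.
Proof.
case: n M => [|n] M Do MD fD; first exact: ex_diff.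
have fders := cont_diff_successive_derivatives fD; have [_ fc] := fD.
have [s] := closed_field_poly_normal (char_poly M).
rewrite (monicP (char_poly_monic M)) scale1r -/(node_poly s) => Ms.
have size_s : size s = n.+1.
  by apply: succn_inj; rewrite -size_node_poly -Ms size_char_poly.
have sD z : z \in s -> D z.
  move=> zs; apply: MD => /=; rewrite eigenvalue_root_char Ms.
  by rewrite root_prod_XsubC.
have nbhsM : Filter (nbhs M) := nbhs_filter M.
have [X|X||x [xs charE xc]] := @roots_cvg _ _ (nbhs M) char_poly s nbhsM.
- exact: char_poly_monic.
- by rewrite size_char_poly size_s.
- by rewrite -Ms; exact: char_poly_cvg.
pose h j := derive1n j f.
pose P X := hermite h (x X ++ s).
have szs X : size (x X ++ s) = (2 * n.+1)%N by rewrite size_cat xs size_s mul2n addnn.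
have nodesE (v : seq C) : size v = size s ->
    map (nth 0 (v ++ s)) (iota 0 (2 * n.+1)) = v ++ s.
  move=> vs; rewrite -[RHS](mkseq_nth 0) /mkseq size_cat vs size_s.
  by rewrite mul2n addnn.
have PP : coef_cvg (nbhs M) P (hermite h (s ++ s)).
  rewrite -(nodesE s erefl); rewrite /P.
  under eq_fun do rewrite -(nodesE _ (xs _)).
  apply: (@hermite_cvg _ _ _ _ _ _ D (2 * n.+1).-1) => //.
  - by rewrite size_iota.
  - move=> i; rewrite mem_iota add0n => /andP[_ i2].
    apply: sD; have : (s ++ s)`_i \in s ++ s.
      by rewrite mem_nth// size_cat size_s addnn -mul2n.
    by rewrite mem_cat orbb.
  - move=> i _; rewrite nth_cat; under eq_fun do rewrite nth_cat xs.
    by case: ltnP => _; [exact: xc | exact: cvg_cst].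
apply: (differentiable_horner_mx (m := (2 * n.+1)%N) _ PP).
- by move=> X; rewrite -(szs X) size_hermite.
- move=> X; apply: mxfunE (@hermiteP _ _ _).
  by rewrite /node_poly big_cat dvdp_mulr// charE.
- move=> X; apply: mxfunE (@hermiteP _ _ _).
  by rewrite /node_poly big_cat dvdp_mull// Ms.
Qed.

End Frechet.

(** * From matrix functions to t-functions *)

Section TensorMaps.
Context {K : numClosedFieldType}.

Lemma tensor_entry_le (n m p : nat) (A : tensor K n m p) k i j : `|A k i j| <= `|A|.
Proof.
rewrite -[leLHS]sqrCK// [leRHS]/(tensor_norm A).
rewrite ler_sqrtC ?nnegrE ?exprn_ge0//; last first.
  by rewrite sumr_ge0// => u _; rewrite exprn_ge0.
by rewrite (bigD1 (k, (i, j)))//= lerDl sumr_ge0// => u _; rewrite exprn_ge0.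
Qed.

(** With [tensor_entry_le], this makes the Frobenius norm on tensors equivalent to
    the maximum norm used on matrices. *)
Lemma tensor_norm_le (n m p : nat) (A : tensor K n m p) (c : K) : 0 <= c ->
  (forall k i j, `|A k i j| <= c) ->
  `|A| <= sqrtC #|{: 'I_p * ('I_n * 'I_m)}|%:R * c.
Proof.
move=> c0 Ac; rewrite [leLHS]/(tensor_norm A).
rewrite -[X in _ * X]sqrCK// -sqrtCM ?nnegrE ?exprn_ge0//.
rewrite ler_sqrtC ?nnegrE ?mulr_ge0 ?exprn_ge0//; last first.
  by rewrite sumr_ge0// => u _; rewrite exprn_ge0.
rewrite mulr_natl -sumr_const ler_sum// => u _.
by rewrite lerXn2r ?nnegrE.
Qed.

Lemma bcirc_is_linear (n m p : nat) : linear (@bcirc K n m p).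
Proof. by move=> c A B; apply/matrixP => i j; rewrite !mxE !ffunE !mxE. Qed.

HB.instance Definition _ (n m p : nat) :=
  GRing.isLinear.Build K (tensor K n m p.+1) _ _ (@bcirc K n m p)
    (@bcirc_is_linear n m p).

Lemma bcirc_continuous (n m p : nat) : continuous (@bcirc K n m p).
Proof.
apply: (@lipschitz_linear_continuous _ _ _ (@bcirc K n m p) 1) => // A.
rewrite mul1r; apply: mx_norm_le => // i j.
by rewrite mxE tensor_entry_le.
Qed.

Definition first_block_column {n p : nat}
    (Y : 'M[K]_(\sum_(r < p.+1) n, \sum_(s < p.+1) n)) : tensor K n n p.+1 :=
  tfold (Y *m E1).

Lemma first_block_column_is_linear (n p : nat) : linear (@first_block_column n p).
Proof.
move=> c X Y; apply/ffunP => k; apply/matrixP => i j.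
by rewrite /first_block_column /tfold mulmxDl -scalemxAl !ffunE !mxE.
Qed.

HB.instance Definition _ (n p : nat) :=
  GRing.isLinear.Build K _ (tensor K n n p.+1) _ (@first_block_column n p)
    (@first_block_column_is_linear n p).

Lemma first_block_column_continuous (n p : nat) : continuous (@first_block_column n p).
Proof.
pose c : K := sqrtC #|{: 'I_p.+1 * ('I_n * 'I_n)}|%:R.
pose N := (\sum_(r < p.+1) n)%N.
apply: (@lipschitz_linear_continuous _ _ _ (@first_block_column n p)
  (c * (N%:R * `|E1 : 'M[K]_(N, n)|))) => [|Y].
  by rewrite !mulr_ge0// sqrtC_ge0.
rewrite -mulrA; apply: tensor_norm_le => [|k i j]; first by rewrite !mulr_ge0.
rewrite /first_block_column ffunE mxE (le_trans (mx_entry_le _ _ _))//.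
by rewrite mulrAC (le_trans (mx_normM _ _)).
Qed.

(** The chain rule for [first_block_column \o mxfun f \o bcirc], whose outer maps
    are linear and continuous, hence their own differentials. *)
Lemma diff_tfun (n p : nat) (f : K -> K) (A : tensor K n n p.+1) :
  differentiable (mxfun f) (bcirc A) ->
  differentiable (tfun f) A /\
  forall E, 'd (tfun f) A E = tfold ('d (mxfun f) (bcirc A) (bcirc E) *m E1).
Proof.
move=> fM.
have dB : differentiable (@bcirc _ n n p) A :=
  linear_differentiable A (@bcirc_continuous n n p).
have dF X : differentiable (@first_block_column n p) X :=
  linear_differentiable X (@first_block_column_continuous n p).
have dG : differentiable (mxfun f \o @bcirc _ n n p) A := differentiable_comp dB fM.
have tE : tfun f = @first_block_column n p \o (mxfun f \o @bcirc _ n n p) by [].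
rewrite tE; split; first exact: differentiable_comp.
move=> E; rewrite (diff_comp dG (dF _)) /=.
rewrite (diff_lin _ (@first_block_column_continuous n p)).
by rewrite (diff_comp dB fM) /= (diff_lin _ (@bcirc_continuous n n p)).
Qed.

End TensorMaps.

Theorem lemma1 (R : realType) (n p : nat) (A : tensor R[i] n n p.+1)
    (f : R[i] -> R[i]) (D : set R[i]) :
  open (D : set R[i]^o) ->
  [set z | eigenvalue (bcirc A) z] `<=` D ->
  cont_diff_on (2 * n * p.+1).-1%N D f ->
  [/\ differentiable (tfun f) A,
      differentiable (mxfun f) (bcirc A) &
      forall C : tensor R[i] n n p.+1,
        'd (tfun f) A C = tfold ('d (mxfun f) (bcirc A) (bcirc C) *m E1)].
Proof.
move=> Do AD fD.
have fM : differentiable (mxfun f) (bcirc A).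
  have cE : (2 * n * p.+1 = 2 * (\sum_(r < p.+1) n))%N.
    by rewrite sum_nat_const card_ord -mulnA [(n * _)%N]mulnC.
  rewrite cE in fD.
  exact: (@differentiable_mxfun R _ (bcirc A) f D Do AD fD).
by have [] := diff_tfun fM.
Qed.
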